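(* Let $p\neq 2$ be a prime, let $n,k,l$ be positive integers with $l\mid k$ and $\frac{k}{l}$ odd, put $d=\gcd(n,k)$, $e=\gcd(n,l)$, $L=\operatorname{lcm}(d,l)$, and let $a\in\mathbb{F}_{p^n}$. Let $\delta\in \mathbb{F}_{p^n}^*$ and $\delta_1\in \mathbb{F}_{p^d}^*$ be any elements such that $T_d^n(\delta)=1$ and $T_{2e}^{2d}(\delta_1)=1$. 1. When $\frac{n}{d}$ is even and $p\mid\frac{k}{L}$, there exists a solution in $\mathbb{F}_{p^n}$ to the equation $S_l^k(X)=a$ if and only if $S_d^n(a)=0$. In that case, $$x_0=T_l^{2l}\Bigl(\sum_{i=0}^{\frac{n}{d}-2}\sum_{j=i+1}^{\frac{n}{d}-1}\delta^{p^{kj}}a^{p^{ki}}(-1)^i\Bigr)$$ is a particular $\mathbb{F}_{p^n}$-solution to the equation $S_l^k(X)=a$. 2. When $\frac{n}{d}$ is even and $p\nmid\frac{k}{L}$, there exists a solution in $\mathbb{F}_{p^n}$ to the equation $S_l^k(X)=a$ if and only if $T_e^{2e}\circ S_d^n(a)=0$. In that case, $$x_0=y_0+\frac{L}{2k}S_d^{2d}\bigl((a-S_l^k(y_0))\delta_1\bigr),\qquad\text{where}\qquad y_0=\sum_{i=0}^{\frac{n}{d}-2}\sum_{j=i+1}^{\frac{n}{d}-1}\delta^{p^{kj}}\bigl(T_l^{2l}(a)\bigr)^{p^{ki}}(-1)^i,$$ is a particular $\mathbb{F}_{p^n}$-solution to the equation $S_l^k(X)=a$. 3. When $\frac{n}{d}$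 is odd, the equation $S_l^k(X)=a$ has a unique $\mathbb{F}_{p^n}$-solution: $$x_0=\frac{T_l^{2l}\circ S_k^{[n,k]}(a)}{2}.$$
   Context: For positive integers $u\mid v$ and a prime $p$, define the linearized polynomials $T_u^v(X)=\sum_{i=0}^{v/u-1}X^{p^{ui}}$ and $S_u^v(X)=\sum_{i=0}^{v/u-1}(-1)^iX^{p^{ui}}$; in particular $T_u^{2u}(X)=X+X^{p^u}$ and $S_u^{2u}(X)=X-X^{p^u}$. $[n,k]$ denotes the least common multiple of $n$ and $k$. All finite fields $\mathbb{F}_{p^m}$ are regarded as subfields of a fixed algebraic closure $\overline{\mathbb{F}_p}$. Since $d\mid k$ and $l\mid k$, $L$ divides $k$, and $e\mid d$. When $p\nmid \frac{k}{L}$ (and $p\ne2$), $\frac{L}{2k}$ denotes the inverse in $\mathbb{F}_p$ of the integer $\frac{2k}{L}$ reduced mod $p$. *)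

(* Defs.v *)
From HB Require Import structures.
From mathcomp Require Import all_boot all_order all_algebra all_field.

Set Implicit Arguments.
Unset Strict Implicit.
Unset Printing Implicit Defensive.

Import GRing.Theory.
Local Open Scope ring_scope.

(* The subfield F_{p^m} of a field K: the fixed points of the m-th iterate of
   the Frobenius map.  When K is algebraically closed of characteristic p, this
   is a subfield with p ^ m elements (GF_divring_closed and GF_card), hence the
   only one. *)
Definition GF (K : fieldType) (p m : nat) : {pred K} :=
  [pred x : K | x ^+ (p ^ m) == x].
Arguments GF : clear implicits.

(* T_u^v; meant for u %| v, with coefficients read in K. *)
Definition Tpoly {K : fieldType} (p u v : nat) : {poly K} :=
  \sum_(0 <= i < v %/ u) 'X^(p ^ (u * i)).

(* S_u^v; meant for u %| v, with coefficients read in K. *)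
Definition Spoly {K : fieldType} (p u v : nat) : {poly K} :=
  \sum_(0 <= i < v %/ u) (-1) ^+ i *: 'X^(p ^ (u * i)).

(* With N = n/d:
   sum_{i=0}^{N-2} sum_{j=i+1}^{N-1} delta^(p^(k j)) b^(p^(k i)) (-1)^i. *)
Definition dsum {K : fieldType} (p k N : nat) (delta b : K) : K :=
  \sum_(0 <= i < N.-1) \sum_(i.+1 <= j < N)
     delta ^+ (p ^ (k * j)) * b ^+ (p ^ (k * i)) * (-1) ^+ i.

Lemma GF_divring_closed (K : fieldType) (p m : nat) :
  p \in [pchar K] -> divring_closed (GF K p m).
Proof.
move=> pK; have pn : [pchar K].-nat (p ^ m)%N.
  by rewrite pnatX pnatE ?(pcharf_prime pK) // pK.
split=> [|x y|x y]; rewrite !inE ?expr1n // => /eqP hx /eqP hy.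
  by rewrite exprDn_pchar // exprNn_pchar // hx hy.
by rewrite exprMn exprVn hx hy.
Qed.

Lemma GF_card (K : closedFieldType) (p m : nat) :
  p \in [pchar K] -> (0 < m)%N ->
  exists s : seq K, [/\ uniq s, size s = (p ^ m)%N & s =i GF K p m].
Proof.
move=> pK m_gt0; have p_gt1 := prime_gt1 (pcharf_prime pK).
have q_gt1 : (1 < p ^ m)%N by rewrite -(expn0 p) ltn_exp2l.
pose f : {poly K} := 'X^(p ^ m) - 'X.
have sz_f : size f = (p ^ m).+1.
  by rewrite size_polyDl ?size_polyXn // size_polyN size_polyX.
have lf : lead_coef f = 1.
  by rewrite lead_coefDl ?lead_coefXn // size_polyN size_polyX size_polyXn.
have [s] := closed_field_poly_normal f; rewrite lf scale1r => Df.
exists s; split.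
- rewrite -separable_prod_XsubC -Df unlock /f derivB derivXn derivX.
  rewrite -mulr_natl (natrX {poly K}) (pcharf0 (R := {poly K})) ?pchar_poly //.
  rewrite expr0n eqn0Ngt m_gt0 mul0r.
  by rewrite sub0r -[- 1]scaleN1r coprimepZr ?coprimep1 // oppr_eq0 oner_neq0.
- by apply: eq_add_S; rewrite -sz_f Df size_prod_XsubC.
by move=> x; rewrite -root_prod_XsubC -Df /root !hornerE inE subr_eq0.
Qed.

(* Main.v *)
Require Import Defs.
From HB Require Import structures.
From mathcomp Require Import all_boot all_order all_algebra.

Set Implicit Arguments.
Unset Strict Implicit.
Unset Printing Implicit Defensive.

Import GRing.Theory.
Local Open Scope ring_scope.

(* Let psi_u x = - x^(p^u).  Then S_u^v(x) is the sum of the first v/u iterates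
   of psi_u at x, T_u^(2u) is 1 - psi_u, and telescoping gives
   (1 - psi_l) S_l^k = 1 - psi_k because k/l is odd.  Hence solving
   S_l^k(X) = a amounts, up to the kernel of 1 - psi_l, to solving
   y - psi_k(y) = b in F_(p^n).
   If n/d is odd, 1 - psi_k is inverted by a sum of iterates of psi_k.  If n/d
   is even, k/d is odd and the additive Hilbert 90 argument applies: the double
   sum solves y - psi_k(y) = b as soon as S_d^n(b) = 0.  In that case d/e and
   l/e are odd, so on the image of S_d^n, which psi_d fixes, the terms of S_l^k
   repeat k/L times; this gives the necessary conditions.  When p does not
   divide k/L, the defect c = a - S_l^k(y0) is fixed by psi_l and psi_d, and the
   trace-one element delta1 turns it into a preimage of 2k/L c. *)

(** * Sums of iterates of an additive map *)

Section IterSum.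

Variable V : zmodType.
Implicit Types (f g : {additive V -> V}) (x : V) (N m c : nat).

Definition itersum (f : V -> V) N x : V := \sum_(0 <= i < N) iter i f x.

Lemma itersum_telescope f N x :
  itersum f N x - f (itersum f N x) = x - iter N f x.
Proof.
have /= := telescope_sumr (fun i => iter i f x) (leq0n N).
rewrite sumrB => /(congr1 -%R); rewrite !opprB => <-.
rewrite /itersum raddf_sum.
by congr (_ - _).
Qed.

Lemma itersum_morph f g N x :
  (forall y, g (f y) = f (g y)) -> g (itersum f N x) = itersum f N (g x).
Proof.
move=> gf; rewrite /itersum raddf_sum; apply: eq_bigr => i _.
by elim: i => //= i IHi; rewrite gf IHi.
Qed.

Fact itersum_is_zmod_morphism f N : zmod_morphism (itersum f N).
Proof.
move=> x y; rewrite /itersum -sumrB; apply: eq_bigr => i _.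
by elim: i => //= i ->; rewrite raddfB.
Qed.

HB.instance Definition _ f N :=
  GRing.isZmodMorphism.Build V V (itersum f N) (itersum_is_zmod_morphism f N).

Lemma eq_itersum (f g : V -> V) N x : f =1 g -> itersum f N x = itersum g N x.
Proof. by move=> fg; apply: eq_bigr => i _; apply: eq_iter. Qed.

Lemma iter_period (f : V -> V) N m x : iter N f x = x -> iter (N * m) f x = x.
Proof.
by move=> fN; elim: m => [|m IHm]; rewrite ?muln0 // mulnS iterD IHm.
Qed.

Lemma iter_modn (f : V -> V) N m x :
  iter N f x = x -> iter (m %% N) f x = iter m f x.
Proof.
by move=> fN; rewrite [in RHS](divn_eq m N) addnC iterD mulnC iter_period.
Qed.

(** Bezout: some multiple of [N] equals a multiple of [m] plus [gcdn N m], and both multiples act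
    trivially on [x]. *)
Lemma iter_gcdn (f : V -> V) N m x : (0 < N)%N ->
  iter N f x = x -> iter m f x = x -> iter (gcdn N m) f x = x.
Proof.
move=> N_gt0 fN fm; case: (egcdnP m N_gt0) => u v uv _.
have := iter_period u fN; rewrite mulnC uv addnC iterD mulnC.
by rewrite (iter_period v fm).
Qed.

Lemma itersum_period (f : V -> V) N m x :
  iter N f x = x -> itersum f (N * m) x = itersum f N x *+ m.
Proof.
move=> fN; elim: m => [|m IHm]; first by rewrite muln0 /itersum big_geq.
rewrite mulrSr -IHm mulnS addnC /itersum.
rewrite (big_cat_nat _ (n := N * m)) ?leq_addr //=; congr (_ + _).
rewrite -{1}[(N * m)%N]add0n big_addn addKn; apply: eq_bigr => i _.
by rewrite iterD iter_period.
Qed.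

(** The iterates of [f] at [x] depend only on the exponent mod [N], and multiplication by [c],
    coprime to [N], permutes the residues. *)
Lemma itersum_iter (f : V -> V) N c x : (0 < N)%N -> coprime N c ->
  iter N f x = x -> itersum (iter c f) N x = itersum f N x.
Proof.
case: N => // N _ cop fN; rewrite /itersum !big_mkord.
pose h (i : 'I_N.+1) : 'I_N.+1 := inord ((c * i) %% N.+1)%N.
have hE i : h i = ((c * i) %% N.+1)%N :> nat by rewrite inordK ?ltn_pmod.
have h_inj : injective h.
  move=> i j /(congr1 val) /=; rewrite !hE => /eqP.
  wlog le_ji : i j / (j <= i)%N => [W|].
    by case/orP: (leq_total j i) => /W // Wij; rewrite eq_sym => /Wij.
  rewrite eqn_mod_dvd ?leq_mul2l ?le_ji ?orbT // -mulnBr Gauss_dvdr //.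
  rewrite -eqn_mod_dvd // !modn_small // => /eqP ij.
  exact: val_inj.
rewrite [RHS](reindex_inj h_inj); apply: eq_bigr => i _.
by rewrite hE iter_modn // mulnC iterM.
Qed.

End IterSum.

(** * Frobenius powers, their negatives, and additive Hilbert 90 *)

Section Frobenius.

Variables (p : nat) (K : fieldType).

(* The unused argument [pK] lets the morphism instances below be inferred. *)
Definition frob (pK : p \in [pchar K]) (u : nat) (x : K) : K := x ^+ (p ^ u).

Hypothesis pK : p \in [pchar K].

Fact frob_is_zmod_morphism u : zmod_morphism (frob pK u).
Proof.
have pn : [pchar K].-nat (p ^ u)%N.
  by rewrite pnatX pnatE ?(pcharf_prime pK) // pK.
by move=> x y; rewrite /frob exprDn_pchar // exprNn_pchar.
Qed.

Fact frob_is_monoid_morphism u : monoid_morphism (frob pK u).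
Proof. by split=> [|x y]; rewrite /frob ?expr1n ?exprMn. Qed.

HB.instance Definition _ u :=
  GRing.isZmodMorphism.Build K K (frob pK u) (frob_is_zmod_morphism u).
HB.instance Definition _ u :=
  GRing.isMonoidMorphism.Build K K (frob pK u) (frob_is_monoid_morphism u).

(* With [psi u] = - Frob^u, both T_u^v and S_u^v are plain iterated sums, and
   T_u^(2u) is the operator 1 - [psi u]. *)
Definition psi (u : nat) (x : K) : K := - frob pK u x.

Fact psi_is_zmod_morphism u : zmod_morphism (psi u).
Proof. by move=> x y; rewrite /psi raddfB opprB opprK addrC. Qed.

HB.instance Definition _ u :=
  GRing.isZmodMorphism.Build K K (psi u) (psi_is_zmod_morphism u).

Local Notation fr := (frob pK).

Lemma frob_fixP n x : reflect (fr n x = x) (x \in GF K p n).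
Proof. rewrite inE; apply: (@eqP _ (fr n x) x). Qed.

Lemma frobD u v x : fr (u + v) x = fr u (fr v x).
Proof. by rewrite /frob addnC expnD exprM. Qed.

Lemma iter_frob u i x : iter i (fr u) x = fr (u * i) x.
Proof.
elim: i => [|i IHi] /=; first by rewrite muln0 /frob expr1.
by rewrite IHi mulnS frobD.
Qed.

Lemma frob_psi u v x : fr u (psi v x) = psi v (fr u x).
Proof. by rewrite /psi raddfN /= -!frobD addnC. Qed.

Lemma psiC u v x : psi u (psi v x) = psi v (psi u x).
Proof. by rewrite /psi !raddfN /= -!frobD addnC. Qed.

Lemma psiM u x y : psi u (x * y) = fr u x * psi u y.
Proof. by rewrite /psi rmorphM mulrN. Qed.

Lemma iter_psi u i x : iter i (psi u) x = (-1) ^+ i * fr (u * i) x.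
Proof.
elim: i => [|i IHi] /=; first by rewrite muln0 mul1r /frob expr1.
by rewrite IHi /psi rmorphM rmorphXn rmorphN1 exprS mulN1r mulNr mulnS frobD.
Qed.

Lemma iter_psi_odd u i x : odd i -> iter i (psi u) x = psi (u * i) x.
Proof. by move=> i_odd; rewrite iter_psi -signr_odd i_odd mulN1r. Qed.

Lemma iter_psi_even u i x : ~~ odd i -> iter i (psi u) x = fr (u * i) x.
Proof. by move=> /negPf i_even; rewrite iter_psi -signr_odd i_even mul1r. Qed.

Lemma horner_Tpoly u v x :
  (Tpoly p u v).[x] = itersum (fr u) (v %/ u)%N x.
Proof.
rewrite /Tpoly horner_sum; apply: eq_bigr => i _.
by rewrite hornerXn iter_frob.
Qed.

Lemma horner_Spoly u v x : (Spoly p u v).[x] = itersum (psi u) (v %/ u)%N x.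
Proof.
rewrite /Spoly horner_sum; apply: eq_bigr => i _.
by rewrite hornerZ hornerXn iter_psi.
Qed.

Lemma horner_Tpoly2 u x : (0 < u)%N -> (Tpoly p u (2 * u)).[x] = x - psi u x.
Proof.
move=> u_gt0; rewrite horner_Tpoly mulnK // /itersum big_nat_recr //=.
by rewrite big_nat1 /= /psi opprK.
Qed.

Lemma horner_Spoly2 u x : (0 < u)%N -> (Spoly p u (2 * u)).[x] = x + psi u x.
Proof.
move=> u_gt0; rewrite horner_Spoly mulnK // /itersum big_nat_recr //=.
by rewrite big_nat1.
Qed.

Lemma frob_itersum_psi n u N x :
  fr n x = x -> fr n (itersum (psi u) N x) = itersum (psi u) N x.
Proof. by move=> fx; rewrite (itersum_morph _ _ (frob_psi n u)) /= fx. Qed.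

Lemma itersum_psiB u N x :
  itersum (psi u) N (x - psi u x) = x - iter N (psi u) x.
Proof.
rewrite -itersum_telescope (itersum_morph N x (psiC u u)) /=.
by rewrite raddfB.
Qed.

Lemma frob_dsum n k N delta b :
  fr n delta = delta -> fr n b = b ->
  fr n (dsum p k N delta b) = dsum p k N delta b.
Proof.
move=> fdelta fb; rewrite /dsum rmorph_sum; apply: eq_bigr => i _.
rewrite rmorph_sum; apply: eq_bigr => j _.
by rewrite !rmorphM !rmorphXn rmorphN1 /= fdelta fb.
Qed.

(** Put [D j] for the conjugates of [delta]. The [i]-th term [g i] of the double sum is a tail of
    the trace of [delta] times the [i]-th iterate at [b]. Applying [psi k] gives [g i.+1] plus
    [delta] times the next iterate, so [y - psi k y] telescopes to the full trace of [delta] times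
    [b]. *)
Lemma dsum_Hilbert90 k N delta b :
  (0 < N)%N -> fr (k * N) delta = delta ->
  itersum (fr k) N delta = 1 -> itersum (psi k) N b = 0 ->
  let y := dsum p k N delta b in y - psi k y = b.
Proof.
case: N => // M _ fdelta tr_delta tr_b /=; pose D j := fr (k * j) delta.
pose g i := (\sum_(i.+1 <= j < M.+1) D j) * iter i (psi k) b.
have -> : dsum p k M.+1 delta b = \sum_(0 <= i < M) g i.
  apply: eq_bigr => i _; rewrite /g mulr_suml; apply: eq_bigr => j _.
  by rewrite iter_psi -mulrA; congr (_ * _); rewrite mulrC.
(* The Frobenius shifts the tail by one index; its new last conjugate, of index [M.+1], wraps around
   to [delta]. *)
have psi_g i : (0 <= i < M)%N ->
    psi k (g i) = g i.+1 + delta * iter i.+1 (psi k) b.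
  move=> ltiM; rewrite psiM -iterS /g -mulrDl; congr (_ * _).
  rewrite rmorph_sum /= -[in RHS]fdelta -/(D _) -big_nat_recr //=.
  rewrite [RHS]big_add1 /=; apply: eq_bigr => j _.
  by rewrite /D mulnS frobD.
have gM : g M = 0 by rewrite /g big_geq ?mul0r.
rewrite raddf_sum /= (eq_big_nat _ _ psi_g) big_split /= -mulr_sumr.
have -> : \sum_(0 <= i < M) g i.+1 = \sum_(0 <= i < M) g i - g 0%N.
  apply/eqP; rewrite eq_sym subr_eq addrC -big_nat_recl //.
  by rewrite big_nat_recr //= gM addr0.
rewrite opprD opprB addrA addrCA subrr addr0.
(* Vanishing of the whole sum of iterates at [b] leaves minus its term of index 0. *)
have -> : \sum_(0 <= i < M) iter i.+1 (psi k) b = - b.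
  apply/eqP; rewrite -addr_eq0 addrC -[X in _ == X]tr_b.
  by rewrite /itersum big_nat_recl.
rewrite mulrN opprK.
have {}tr_delta : \sum_(0 <= i < M) D i.+1 + delta = 1.
  rewrite -tr_delta /itersum big_nat_recl //= addrC; congr (_ + _).
  by apply: eq_bigr => i _; rewrite -iterS iter_frob.
by rewrite /g big_add1 /= -mulrDl tr_delta mul1r.
Qed.

Lemma itersum_psiM u N t x :
  fr u t = t -> itersum (psi u) N (t * x) = t * itersum (psi u) N x.
Proof.
move=> ft; rewrite /itersum mulr_sumr; apply: eq_bigr => i _.
by elim: i => //= i ->; rewrite psiM ft.
Qed.

(** The Frobenius negates [c], which cancels the sign in [psi u]: the alternating sum becomes a
    trace. *)
Lemma itersum_psi_fixed u N x c :
  psi u c = c -> itersum (psi u) N (x * c) = itersum (fr u) N x * c.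
Proof.
move=> fc; rewrite /itersum mulr_suml; apply: eq_bigr => i _.
by elim: i => //= i ->; rewrite psiM fc.
Qed.

Lemma itersum_psi_odd_mul u c N x :
  (0 < N)%N -> odd c -> coprime N c -> iter N (psi u) x = x ->
  itersum (psi (u * c)) N x = itersum (psi u) N x.
Proof.
move=> N_gt0 c_odd cop xN; rewrite -(itersum_iter N_gt0 cop xN).
by apply: eq_itersum => y; rewrite iter_psi_odd.
Qed.

Lemma itersum_frob_mul u c N x :
  (0 < N)%N -> coprime N c -> fr (u * N) x = x ->
  itersum (fr (u * c)) N x = itersum (fr u) N x.
Proof.
move=> N_gt0 cop; rewrite -iter_frob => xN.
rewrite -(itersum_iter N_gt0 cop xN).
by apply: eq_itersum => y; rewrite iter_frob.
Qed.

Lemma psi_fixed_mul u c x : odd c -> psi u x = x -> psi (u * c) x = x.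
Proof.
move=> c_odd ux; rewrite -iter_psi_odd //.
by rewrite -[c]mul1n; apply: iter_period.
Qed.

Lemma psi_fixed_coprime u c c' x :
  (0 < c)%N -> coprime c c' -> iter c (psi u) x = x -> iter c' (psi u) x = x ->
  psi u x = x.
Proof.
by move=> c_gt0 /eqP cop xc xc'; have := iter_gcdn c_gt0 xc xc'; rewrite cop.
Qed.

(** Used with [u] equal to d and [u * c] equal to k: as [c] is coprime to [N], steps [u] and [u * c]
    run through the same orbits, so conditions on T_d^n and S_d^n serve for k. *)
Lemma dsum_Hilbert90_coprime u c N delta b :
  (0 < N)%N -> odd c -> ~~ odd N -> coprime N c ->
  fr (u * N) delta = delta -> fr (u * N) b = b ->
  itersum (fr u) N delta = 1 -> itersum (psi u) N b = 0 ->
  let y := dsum p (u * c) N delta b in y - psi (u * c) y = b.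
Proof.
move=> N_gt0 c_odd N_even cop fdelta fb tr_delta tr_b.
apply: dsum_Hilbert90 => //.
- by rewrite mulnAC -iter_frob -[c]mul1n iter_period.
- by rewrite itersum_frob_mul.
by rewrite itersum_psi_odd_mul // iter_psi_even.
Qed.

Lemma itersum_psi_image_fixed u N x :
  iter N (psi u) x = x -> psi u (itersum (psi u) N x) = itersum (psi u) N x.
Proof.
by move=> xN; apply/esym/eqP; rewrite -subr_eq0 itersum_telescope xN subrr.
Qed.

End Frobenius.

(** Here [D] = d/e, [E] = l/e, [q] = k/L and [N] = n/d; every later divisibility or parity fact is
    read off these factors. [D * q] is k/l, hence odd. *)
Lemma gcdn_lcmn_decomp n k l :
  (0 < n)%N -> (0 < k)%N -> (0 < l)%N -> (l %| k)%N -> odd (k %/ l)%N ->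
  ~~ odd (n %/ gcdn n k)%N ->
  exists D E q N, [/\ gcdn n k = gcdn n l * D, l = gcdn n l * E,
    lcmn (gcdn n k) l = gcdn n l * D * E, n = gcdn n l * D * N
    & k = gcdn n l * D * E * q]%N /\
    [/\ [/\ 0 < gcdn n l, 0 < D, 0 < E, 0 < q & 0 < N]%N,
     [/\ odd D, odd E, odd q & ~~ odd N] &
     [/\ coprime D E, coprime (D * N) E & coprime N (E * q)]].
Proof.
move=> n_gt0 k_gt0 l_gt0 l_k kl_odd N_even.
set e := gcdn n l; set d := gcdn n k.
have e_gt0 : (0 < e)%N by rewrite gcdn_gt0 n_gt0.
have d_gt0 : (0 < d)%N by rewrite gcdn_gt0 n_gt0.
have e_d : (e %| d)%N.
  by rewrite dvdn_gcd dvdn_gcdl (dvdn_trans (dvdn_gcdr n l)).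
have [D Dd] : exists D, d = (e * D)%N by exists (d %/ e)%N; rewrite mulnC divnK.
have [E El] : exists E, l = (e * E)%N.
  by exists (l %/ e)%N; rewrite mulnC divnK ?dvdn_gcdr.
have [N Nn] : exists N, n = (d * N)%N.
  by exists (n %/ d)%N; rewrite mulnC divnK ?dvdn_gcdl.
have gcd_dl : gcdn d l = e.
  by rewrite /d -gcdnA (gcdn_idPr l_k).
have D_gt0 : (0 < D)%N by move: d_gt0; rewrite Dd muln_gt0 => /andP[].
have E_gt0 : (0 < E)%N by move: l_gt0; rewrite El muln_gt0 => /andP[].
have N_gt0 : (0 < N)%N by move: n_gt0; rewrite Nn muln_gt0 => /andP[].
have DL : lcmn d l = (e * D * E)%N.
  apply/eqP; rewrite -(eqn_pmul2r e_gt0) -{1}gcd_dl muln_lcm_gcd Dd El.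
  by rewrite -!mulnA (mulnC E).
have [q kq] : exists q, k = (e * D * E * q)%N.
  exists (k %/ lcmn d l)%N; rewrite -DL mulnC divnK // dvdn_lcm l_k.
  by rewrite dvdn_gcdr.
exists D, E, q, N; split; first by split=> //; rewrite -Dd.
have q_gt0 : (0 < q)%N by move: k_gt0; rewrite kq muln_gt0 => /andP[].
have Dq_odd : odd (D * q).
  have kl : k = (D * q * l)%N.
    rewrite El mulnACA kq [(D * e)%N]mulnC [(q * E)%N]mulnC.
    by rewrite mulnA.
  by move: kl_odd; rewrite kl mulnK.
have {}N_even : ~~ odd N by move: N_even; rewrite -/d {1}Nn mulKn.
(* Both coprimalities come from dividing a gcd by itself: gcd(n,k) = d, then gcd(n,l) = e. *)
have copNk : coprime N (E * q).
  rewrite /coprime -(eqn_pmul2l d_gt0) muln_gcdr -Nn muln1.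
  by rewrite {1}Dd mulnA -kq.
have copE : coprime (D * N) E.
  rewrite /coprime -(eqn_pmul2l e_gt0) muln_gcdr -El muln1.
  by rewrite mulnA -Dd -Nn.
(* [N] is even, so an even [E] would share the factor 2 with [D * N]. *)
have E_odd : odd E.
  apply/negPn/negP => E_even.
  move: copE; rewrite /coprime; have : (2 %| gcdn (D * N) E)%N.
    by rewrite dvdn_gcd !dvdn2 oddM (negPf N_even) andbF E_even.
  by move=> h /eqP h1; rewrite h1 in h.
move: Dq_odd; rewrite oddM => /andP[D_odd q_odd].
by split; split=> //; move: copE; rewrite coprimeMl => /andP[].
Qed.

Section Equation.

Variables (p : nat) (K : fieldType) (pK : p \in [pchar K]).
Local Notation fr := (frob pK).
Local Notation psi := (psi pK).

Lemma itersum_psiB_odd l m y :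
  odd m -> itersum (psi l) m (y - psi l y) = y - psi (l * m)%N y.
Proof. by move=> m_odd; rewrite itersum_psiB iter_psi_odd. Qed.

(** * Case n/d odd, with [u] = d, [c] = k/d and [m] = k/l *)

Section Odd.

Variables (u c N l m : nat).
Hypotheses (N_odd : odd N) (m_odd : odd m) (lm_uc : (l * m)%N = (u * c)%N).
Hypothesis two_neq0 : (2 : K) != 0.

(** A kernel element is fixed by the map [psi] of index k, hence by its [N]-th iterate. As [N] is
    odd, that iterate is minus a Frobenius power fixing [x], so [x] = -[x]. *)
Lemma odd_injective x :
  fr (u * N) x = x -> itersum (psi l) m x = 0 -> x = 0.
Proof.
move=> fx Sx.
have ucx : psi (u * c) x = x.
  apply/esym/eqP; rewrite -lm_uc -subr_eq0 -itersum_psiB_odd // raddfB /= Sx.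
  by rewrite -(itersum_morph _ _ (psiC pK l l)) /= Sx raddf0 subrr.
have : psi (u * c * N) x = x by apply: psi_fixed_mul.
rewrite /psi mulnAC -iter_frob -[c]mul1n (iter_period _ (N := 1)) // => /eqP.
rewrite eq_sym -subr_eq0 opprK -mulr2n -mulr_natl mulf_eq0 (negPf two_neq0).
by move/eqP.
Qed.

(** Telescoping twice gives [a] minus the [N]-th iterate at [a], which is -[a] for odd [N]; the
    factor 2 is then cancelled. *)
Lemma odd_solution a : fr (u * N) a = a ->
  let P := itersum (psi (u * c)) N a in
  itersum (psi l) m ((P - psi l P) / 2) = a.
Proof.
move=> fa P; rewrite mulrC itersum_psiM; last by rewrite fmorphV rmorph_nat.
rewrite itersum_psiB_odd // lm_uc itersum_telescope iter_psi_odd //.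
rewrite /psi opprK mulnAC -iter_frob -[c]mul1n (iter_period _ (N := 1)) //.
by rewrite -mulr2n -(mulr_natl a) mulKf.
Qed.

End Odd.

(** * Case n/d even, in terms of the factors [e], [D], [E], [q], [N] *)

Section Even.

Variables (e D E q N : nat).
Hypotheses (D_gt0 : (0 < D)%N) (E_gt0 : (0 < E)%N) (N_gt0 : (0 < N)%N).
Hypotheses (D_odd : odd D) (E_odd : odd E) (q_odd : odd q).
Hypotheses (N_even : ~~ odd N).
Hypotheses (copDE : coprime D E) (copDNE : coprime (D * N) E).
Hypotheses (copN : coprime N (E * q)).

Local Notation d := (e * D)%N.
Local Notation l := (e * E)%N.
Local Notation n := (e * D * N)%N.
Local Notation k := (e * D * E * q)%N.

(** The two sums commute. Since [l * D] = [d * E] with [D] and [E] odd, a fixed point of [psi d] has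
    period [D] under [psi l], and the [D * q] terms group into [q] equal blocks. *)
Lemma itersum_psi_comp x : fr n x = x ->
  let z := itersum (psi d) N x in
  [/\ psi d z = z, iter D (psi l) z = z &
    itersum (psi d) N (itersum (psi l) (D * q) x)
      = itersum (psi l) D z *+ q].
Proof.
move=> fx z; have dz : psi d z = z.
  by apply: itersum_psi_image_fixed; rewrite iter_psi_even.
have lz : iter D (psi l) z = z.
  by rewrite iter_psi_odd // mulnAC psi_fixed_mul.
split=> //; rewrite -itersum_period // -/z.
rewrite (itersum_morph (f := psi l) (g := itersum (psi d) N)) // => y.
by rewrite [RHS](itersum_morph _ _ (psiC pK l d)).
Qed.

(** [w] is fixed by [psi d] and [psi l], the [D]-th and [E]-th iterates of [psi e], and [D], [E] are
    coprime. *)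
Lemma itersum_psi_image x : fr n x = x ->
  let w := itersum (psi d) N (itersum (psi l) (D * q) x) in psi e w = w.
Proof.
move=> fx w; have [dz lz] := itersum_psi_comp fx; rewrite -/w => ->.
set z := itersum (psi d) N x in dz lz *.
have lw := itersum_psi_image_fixed lz.
have dw : psi d (itersum (psi l) D z) = itersum (psi l) D z.
  by rewrite (itersum_morph _ _ (psiC pK d l)) /= dz.
rewrite raddfMn /=; congr (_ *+ _).
by apply: (psi_fixed_coprime D_gt0 copDE); rewrite iter_psi_odd.
Qed.

Lemma dsum_solution delta b :
  fr n delta = delta -> fr n b = b -> itersum (fr d) N delta = 1 ->
  itersum (psi d) N b = 0 ->
  let y := dsum p k N delta b in fr n y = y /\ y - psi k y = b.
Proof.
move=> fdelta fb tr_delta tr_b y; split; first exact: frob_dsum.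
rewrite /y -mulnA; apply: dsum_Hilbert90_coprime => //.
by rewrite oddM E_odd.
Qed.

Lemma l_mul_Dq : (l * (D * q))%N = k.
Proof. by rewrite mulnACA mulnA [(e * D * E)%N]mulnC. Qed.

(** [c] is fixed by [psi e], hence by [psi d], so the argument is twice [c * delta1]. Pulling out
    [c] leaves [q] copies of a trace of [delta1] with step [l]; it equals the one with step [2 * e],
    since [D] is coprime to both [E] and 2. *)
Lemma correction_term c delta1 :
  fr n c = c -> psi l c = c -> fr d delta1 = delta1 ->
  itersum (fr (2 * e)) D delta1 = 1 ->
  itersum (psi l) (D * q) (c * delta1 + psi d (c * delta1)) = c *+ (2 * q).
Proof.
move=> fc lc fdelta1 tr_delta1.
have ec : psi e c = c.
  have DN_gt0 : (0 < D * N)%N by rewrite muln_gt0 D_gt0.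
  apply: (psi_fixed_coprime DN_gt0 copDNE); last by rewrite iter_psi_odd.
  by rewrite iter_psi_even ?mulnA // oddM (negPf N_even) andbF.
have dc : psi d c = c by apply: psi_fixed_mul.
have cop2 : coprime D 2 by rewrite coprimen2.
rewrite mulrC psiM fdelta1 dc -mulr2n raddfMn /= itersum_psi_fixed //.
rewrite itersum_period; last first.
  by rewrite iter_frob mulnAC -iter_frob -[E]mul1n iter_period.
rewrite itersum_frob_mul // -(itersum_frob_mul _ cop2) // (mulnC e) tr_delta1.
by rewrite mulr_natl -mulrnA mulnC.
Qed.

End Even.
End Equation.

(* (K, iota) is an arbitrary algebraic closure of F_p. *)
Theorem theorem6 (p : nat) (p_prime : prime p) (p_neq2 : p <> 2%N)
    (K : closedFieldType) (iota : {rmorphism 'F_p -> K})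
    (K_alg : integralRange iota)
    (n k l : nat) (n_gt0 : (0 < n)%N) (k_gt0 : (0 < k)%N) (l_gt0 : (0 < l)%N)
    (l_dvd_k : (l %| k)%N) (kl_odd : odd (k %/ l)) :
  let d := gcdn n k in
  let e := gcdn n l in
  let L := lcmn d l in
  forall (a : K) (a_GF : a \in GF K p n)
    (delta : K) (delta_GF : delta \in GF K p n) (delta_neq0 : delta != 0)
    (delta1 : K) (delta1_GF : delta1 \in GF K p d) (delta1_neq0 : delta1 != 0)
    (delta_T : (Tpoly p d n).[delta] = 1)
    (delta1_T : (Tpoly p (2 * e) (2 * d)).[delta1] = 1),
  [/\ (~~ odd (n %/ d) -> (p %| k %/ L)%N ->
        ((exists2 x : K, x \in GF K p n & (Spoly p l k).[x] = a)
           <-> (Spoly p d n).[a] = 0)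
        /\ ((Spoly p d n).[a] = 0 ->
            let x0 := (Tpoly p l (2 * l)).[dsum p k (n %/ d) delta a] in
            x0 \in GF K p n /\ (Spoly p l k).[x0] = a)),
      (~~ odd (n %/ d) -> ~~ (p %| k %/ L)%N ->
        ((exists2 x : K, x \in GF K p n & (Spoly p l k).[x] = a)
           <-> (Tpoly p e (2 * e) \Po Spoly p d n).[a] = 0)
        /\ ((Tpoly p e (2 * e) \Po Spoly p d n).[a] = 0 ->
            let y0 := dsum p k (n %/ d) delta (Tpoly p l (2 * l)).[a] in
            let x0 := y0 + iota ((2 * k %/ L)%:R^-1)
                        * (Spoly p d (2 * d)).[(a - (Spoly p l k).[y0]) * delta1] in
            x0 \in GF K p n /\ (Spoly p l k).[x0] = a))
    & (odd (n %/ d) ->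
        unique (fun x : K => x \in GF K p n /\ (Spoly p l k).[x] = a)
          ((Tpoly p l (2 * l) \Po Spoly p k (lcmn n k)).[a] / 2))].
Proof.
move=> d e L a a_GF delta delta_GF _ delta1 delta1_GF _ delta_T delta1_T.
have pK : p \in [pchar K] by rewrite (fmorph_pchar iota) pchar_Fp.
have two_neq0 : (2 : K) != 0.
  by rewrite -(dvdn_pcharf pK) dvdn_prime2 //; apply/eqP.
have d_gt0 : (0 < d)%N by rewrite gcdn_gt0 n_gt0.
have fa : frob pK n a = a by apply/frob_fixP.
have fdelta : frob pK n delta = delta by apply/frob_fixP.
have fdelta1 : frob pK d delta1 = delta1 by apply/frob_fixP.
rewrite !(horner_Tpoly pK) in delta_T delta1_T.
have [N_odd|N_even] := boolP (odd (n %/ d)).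
  split=> // _.
  have Dn : n = (d * (n %/ d))%N by rewrite mulnC divnK ?dvdn_gcdl.
  have Dk : k = (d * (k %/ d))%N by rewrite mulnC divnK ?dvdn_gcdr.
  (* S_k^[n,k] thus has n/d terms, the [N] of the odd case. *)
  have lcmE : (lcmn n k %/ k = n %/ d)%N.
    apply/eqP; rewrite -(eqn_pmul2r k_gt0) divnK ?dvdn_lcmr //.
    by rewrite -(eqn_pmul2r d_gt0) muln_lcm_gcd mulnAC divnK ?dvdn_gcdl.
  rewrite horner_comp horner_Tpoly2 // !horner_Spoly lcmE.
  have lmE : (l * (k %/ l))%N = (d * (k %/ d))%N by rewrite -Dk mulnC divnK.
  set x0 := _ / 2.
  have fx0 : frob pK n x0 = x0.
    by rewrite rmorphM fmorphV rmorph_nat raddfB /= frob_psi frob_itersum_psi.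
  have Sx0 : itersum (psi pK l) (k %/ l) x0 = a.
    rewrite /x0 [in psi pK k]Dk.
    by apply: (odd_solution N_odd kl_odd lmE two_neq0); rewrite -Dn.
  split; first by split; [apply/(frob_fixP pK) | rewrite horner_Spoly].
  move=> x [/(frob_fixP pK) fx]; rewrite (horner_Spoly pK) => Sx.
  apply/eqP; rewrite -subr_eq0; apply/eqP.
  apply: (odd_injective (pK := pK) N_odd kl_odd lmE two_neq0).
    by rewrite -Dn raddfB /= fx0 fx.
  by rewrite raddfB /= Sx0 Sx subrr.
have [D [E [q [N]]]] :=
  gcdn_lcmn_decomp n_gt0 k_gt0 l_gt0 l_dvd_k kl_odd N_even.
rewrite -/d -/e -/L => -[[Dd El DL Dn Dk]].
move=> [[e_gt0 D_gt0 E_gt0 q_gt0 N_gt0] [D_odd E_odd q_odd N'_even]].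
move=> [copDE copDNE copN].
have nd : (n %/ d = N)%N by rewrite Dd Dn mulKn // muln_gt0 e_gt0.
have kL : (k %/ L = q)%N by rewrite DL Dk mulKn // !muln_gt0 e_gt0 D_gt0.
have kl : (k %/ l = D * q)%N.
  by rewrite Dk {1}El -l_mul_Dq mulKn // muln_gt0 e_gt0.
have k2L : (2 * k %/ L = 2 * q)%N.
  by rewrite DL Dk mulnCA mulKn // !muln_gt0 e_gt0 D_gt0.
have de : (2 * d %/ (2 * e) = D)%N.
  by rewrite Dd mulnA mulKn // muln_gt0.
rewrite nd kL k2L de in delta_T delta1_T *.
clearbody d e L; subst d l n k.
have Dq_odd : odd (D * q) by rewrite oddM D_odd.
have hS x : (Spoly p (e * E) (e * D * E * q)).[x]
    = itersum (psi pK (e * E)) (D * q) x by rewrite (horner_Spoly pK) kl.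
have SB y : itersum (psi pK (e * E)) (D * q) (y - psi pK (e * E) y)
    = y - psi pK (e * D * E * q) y by rewrite itersum_psiB_odd // l_mul_Dq.
have Q_neq0 : ~~ (p %| q)%N -> (2 * q)%:R != 0 :> K.
  by move=> p_q; rewrite natrM mulf_neq0 // -(dvdn_pcharf pK).
split=> [_ p_q|_ p_q|//].
- rewrite (horner_Spoly pK) nd.
  have sol : itersum (psi pK (e * D)) N a = 0 ->
      let x0 := (Tpoly p (e * E) (2 * (e * E))).[
                  dsum p (e * D * E * q) N delta a] in
      x0 \in GF K p (e * D * N) /\ (Spoly p (e * E) (e * D * E * q)).[x0] = a.
    move=> Sa x0; rewrite hS /x0 (horner_Tpoly2 pK) // SB.
    have [fy ->] :=
      dsum_solution N_gt0 E_odd q_odd N'_even copN fdelta fa delta_T Sa.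
    by split=> //; apply/(frob_fixP pK); rewrite raddfB /= frob_psi fy.
  split=> //; split=> [[x /(frob_fixP pK) fx]|Sa].
    rewrite hS => <-.
    have [_ _ ->] := itersum_psi_comp q D_odd E_odd N'_even fx.
    (* The composite is a [q]-fold multiple, which vanishes because p divides [q]. *)
    by apply/eqP; rewrite -mulr_natr mulf_eq0 -(dvdn_pcharf pK) p_q orbT.
  by have [] := sol Sa; exists (Tpoly p (e * E) (2 * (e * E))).[
                  dsum p (e * D * E * q) N delta a].
rewrite horner_comp (horner_Spoly pK) nd (horner_Tpoly2 pK) //.
rewrite (horner_Tpoly2 pK) //.
set y0 := dsum _ _ _ _ _ => /=; set x0 := y0 + _.
have sol :
    itersum (psi pK (e * D)) N a - psi pK e (itersum (psi pK (e * D)) N a) = 0 ->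
    x0 \in GF K p (e * D * N) /\ (Spoly p (e * E) (e * D * E * q)).[x0] = a.
  move=> /eqP; rewrite subr_eq0 eq_sym => /eqP ea.
  have fb : frob pK (e * D * N) (a - psi pK (e * E) a) = a - psi pK (e * E) a.
    by rewrite raddfB /= frob_psi fa.
  (* S_d^n commutes with 1 - [psi l], and S_d^n(a), fixed by [psi e], is fixed by [psi l] because
     [E] is odd. *)
  have Sb : itersum (psi pK (e * D)) N (a - psi pK (e * E) a) = 0.
    rewrite raddfB /= -(itersum_morph _ _ (psiC pK (e * E) (e * D))) /=.
    by rewrite psi_fixed_mul // subrr.
  have [fy Sy] :=
    dsum_solution N_gt0 E_odd q_odd N'_even copN fdelta fb delta_T Sb.
  rewrite -/y0 in fy Sy; 
  pose c := a - (Spoly p (e * E) (e * D * E * q)).[y0].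
  have fc : frob pK (e * D * N) c = c.
    by rewrite /c raddfB /= fa hS frob_itersum_psi.
  (* S_l^k(y0) and [a] have the same image under 1 - [psi l], so their difference [c] is fixed by
     [psi l]. *)
  have QS : (Spoly p (e * E) (e * D * E * q)).[y0]
      - psi pK (e * E) (Spoly p (e * E) (e * D * E * q)).[y0]
      = a - psi pK (e * E) a.
    rewrite !hS (itersum_morph _ _ (psiC pK (e * E) (e * E))).
    by rewrite -raddfB /= SB Sy.
  have Qc : psi pK (e * E) c = c.
    apply/esym/eqP; rewrite -subr_eq0 raddfB opprD opprK addrACA -QS.
    by rewrite addrACA subrr addNr addr0.
  have Sc := correction_term q D_gt0 N_gt0 D_odd E_odd N'_even copDE copDNE
    fc Qc fdelta1 delta1_T.
  (* The scalar lies in the prime field, so it passes through every Frobenius power. *)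
  have ft u : frob pK u (iota (2 * q)%:R^-1) = iota (2 * q)%:R^-1.
    by rewrite fmorphV rmorph_nat fmorphV rmorph_nat.
  rewrite hS /x0 (horner_Spoly2 pK) // -/c; split.
    have fd : frob pK (e * D * N) delta1 = delta1.
      by rewrite -iter_frob -[N]mul1n iter_period.
    have fcd : frob pK (e * D * N) (c * delta1) = c * delta1.
      by rewrite rmorphM /= fc fd.
    apply/(frob_fixP pK); rewrite raddfD /= fy rmorphM /= ft.
    by rewrite (raddfD (frob pK _)) /= frob_psi fcd.
  (* The correction contributes exactly [c], the amount by which S_l^k(y0) misses [a]. *)
  rewrite raddfD /= itersum_psiM // Sc -(mulr_natl c) fmorphV rmorph_nat.
  by rewrite mulKf ?Q_neq0 // /c hS addrC subrK.
split=> //; split=> [[x /(frob_fixP pK) fx]|/sol[]]; last by exists x0.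
rewrite hS => <-; apply/eqP; rewrite subr_eq0 eq_sym; apply/eqP.
exact: itersum_psi_image.
Qed.
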